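(* Let $n,m\ge 1$, $M\in\mathbb{R}^{n\times m}$, $\eta>0$, and let $a\in\mathbb{R}^n$, $b\in\mathbb{R}^m$ have strictly positive entries with $\sum_{i=1}^n a_i=\sum_{j=1}^m b_j=1$. Let $f:\mathbb{R}^{n+m-1}\to\mathbb{R}$ be the (negative) dual objective of entropic-regularized optimal transport with data $(M,a,b,\eta)$, as defined in the context, and let $f^*$ be the optimal (minimum) value of $f$. Let $S\ge 2$ be a pre-specified integer, and let $\{x_k\}$ be a sequence of iterates in $\mathbb{R}^{n+m-1}$ with initial value $x_0$ such that: (i) for every $k\ge 1$ with $k\neq iS$, $i=1,2,\ldots$, the point $x_k$ is generated by the SPLR algorithm, i.e. it is the output of one SPLR step with current iterate $x_{k-1}$; (ii) for every $k=iS$, $i=1,2,\ldots$, letting $x_k^q$ be the next iterate of $x_{k-1}$ using one SPLR step, and letting $x_k^s$ be an arbitrary point, we set $x_k=x_k^s$ if $f(x_k^s)\le f(x_k^q)$, and $x_k=x_k^q$ otherwise. Then the iterates $\{x_k\}$ at least have a linear convergence rate; that is, there exists a constant $0<r<1$ such that $$f(x_k)-f^*\le r\,[f(x_{k-1})-f^*]\qquad\text{for all }k\ge 1.$$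
   Context: **Objective.** For $x=(\alpha,\beta_{-m})\in\mathbb{R}^{n+m-1}$ with $\alpha\in\mathbb{R}^n$ and $\beta_{-m}=(\beta_1,\ldots,\beta_{m-1})^T\in\mathbb{R}^{m-1}$, put $\beta_m=0$ and $\beta=(\beta_1,\ldots,\beta_m)^T$. Define $$f(x)=\eta\sum_{i=1}^n\sum_{j=1}^m\exp\{\eta^{-1}(\alpha_i+\beta_j-M_{ij})\}-\alpha^Ta-\beta^Tb .$$ Let $T=T(x)\in\mathbb{R}^{n\times m}$ have entries $T_{ij}=\exp\{(\alpha_i+\beta_j-M_{ij})/\eta\}$, and let $T_{-m}$ be $T$ with its $m$-th column removed. $\mathbf{1}_p$ is the all-ones vector in $\mathbb{R}^p$, $\mathbf{diag}(v)$ is the diagonal matrix with diagonal $v$, and $\Vert\cdot\Vert$ is the Euclidean norm. **Sparsified Hessian.** A sparsification scheme is an index set $\Omega\subseteq\{(i,j):1\le i\le n,\,1\le j\le m-1\}$; it is always assumed that $\Omega\supseteq\Omega^*=\{(i,j): i=1\text{ or }j=1,\ 1\le i\le n,\ 1\le j\le m-1\}$. Given $x$ and $\Omega$, let $T_{-m}^\Omega\in\mathbb{R}^{n\times(m-1)}$ have $(i,j)$ entry $T_{ij}$ if $(i,j)\in\Omega$ and $0$ otherwise, and let $$H_\Omega=\eta^{-1}\begin{bmatrix}\mathbf{diag}(T\mathbf{1}_m)&T_{-m}^\Omega\\(T_{-m}^\Omega)^T&\mathbf{diag}(T_{-m}^T\mathbf{1}_n)\end{bmatrix}.$$ **One step of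 the SPLR (sparse-plus-low-rank quasi-Newton) algorithm.** Fixed constants: $\tau_{\max}>0$, $0<c_1<1/2$, $c_1<c_2<1$. Input: the previous iterate $x^-$ with its gradient $g^-=\nabla f(x^-)$, and the current iterate $x$. The step outputs the next iterate $x^+$ as follows. 1. Set $g=\nabla f(x)$, $s^-=x-x^-$, $y^-=g-g^-$, and $\tau=\min\{\tau_{\max},\Vert g\Vert\}$. 2. Determine a sparsification scheme $\Omega\supseteq\Omega^*$ (it may vary from step to step) and form $H_\Omega$ at $x$. 3. If $(y^-)^Ts^->10^{-6}\Vert y^-\Vert^2$, set $R=\xi uu^T+\zeta vv^T$ with $u=y^-$, $v=(H_\Omega+\tau I)s^-$, $\xi=1/((y^-)^Ts^-)$, $\zeta=-1/(v^Ts^-)$; otherwise set $R=0$. 4. Set $B=H_\Omega+R+\tau I$ and $d=-B^{-1}g$. 5. Output $x^+=x+\gamma d$, where the step size $\gamma>0$ is selected by a line search so that the Wolfe conditions hold: $$f(x^+)\le f(x)+c_1\gamma g^Td,\qquad [\nabla f(x^+)]^Td\ge c_2\,g^Td .$$ When the step is applied with current iterate $x=x_{k-1}$, the previous iterate is $x^-=x_{k-2}$. For $k=1$, the previous iterate $x^-$ is an input of the algorithm on which no particular choice is imposed. *)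

(* Defs.v *)
From HB Require Import structures.
From mathcomp Require Import all_boot all_order all_algebra.
From mathcomp Require Import all_classical all_reals all_analysis.

Set Implicit Arguments.
Unset Strict Implicit.
Unset Printing Implicit Defensive.

Import Order.TTheory GRing.Theory Num.Theory.
Import numFieldNormedType.Exports.
Local Open Scope ring_scope.

(* Indices are 0-based. The space R^(n+m-1) is 'cV[R]_(n + m.-1), intended for
   0 < m; a vector x of it is col_mx alpha beta_{-m}. *)

(* `|_| on matrices is the max norm, hence a separate Euclidean norm. *)
Definition dot (R : realType) (p : nat) (u v : 'cV[R]_p) : R :=
  (u^T *m v) 0 0.

Definition enorm (R : realType) (p : nat) (u : 'cV[R]_p) : R :=
  Num.sqrt (dot u u).

Definition gradient (R : realType) (p : nat) (F : 'cV[R]_p -> R)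
    (x : 'cV[R]_p) : 'cV[R]_p :=
  \col_(i < p) 'D_(delta_mx i 0) F x.

Definition alpha_of (R : realType) (n m : nat) (x : 'cV[R]_(n + m.-1)) :
  'cV[R]_n := usubmx x.

(* insub (val j) is None exactly for the last index of 'I_m, where the dual
   variable is pinned to 0. *)
Definition beta_of (R : realType) (n m : nat) (x : 'cV[R]_(n + m.-1)) :
    'cV[R]_m :=
  \col_(j < m)
    oapp (fun j' : 'I_m.-1 => dsubmx x j' 0) 0 (insub (val j)).

Definition plan (R : realType) (n m : nat) (M : 'M[R]_(n, m)) (eta : R)
    (x : 'cV[R]_(n + m.-1)) : 'M[R]_(n, m) :=
  \matrix_(i < n, j < m)
    expR ((alpha_of x i 0 + beta_of x j 0 - M i j) / eta).

Definition ot_dual (R : realType) (n m : nat) (M : 'M[R]_(n, m))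
    (a : 'cV[R]_n) (b : 'cV[R]_m) (eta : R) (x : 'cV[R]_(n + m.-1)) : R :=
  eta * (\sum_(i < n) \sum_(j < m)
           expR (eta^-1 * (alpha_of x i 0 + beta_of x j 0 - M i j)))
  - dot (alpha_of x) a - dot (beta_of x) b.

Definition drop_last_col (R : realType) (n m : nat) (T : 'M[R]_(n, m)) :
    'M[R]_(n, m.-1) :=
  colsub (widen_ord (leq_pred m)) T.

Definition sparsify (R : realType) (n p : nat) (Omega : {set 'I_n * 'I_p})
    (A : 'M[R]_(n, p)) : 'M[R]_(n, p) :=
  \matrix_(i < n, j < p) (if (i, j) \in Omega then A i j else 0).

Definition Omega_star (n p : nat) : {set 'I_n * 'I_p} :=
  [set ij | (val ij.1 == 0%N) || (val ij.2 == 0%N)].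

Definition H_sparse (R : realType) (n m : nat) (M : 'M[R]_(n, m)) (eta : R)
    (Omega : {set 'I_n * 'I_m.-1}) (x : 'cV[R]_(n + m.-1)) :
    'M[R]_(n + m.-1) :=
  let T := plan M eta x in
  let Tm := drop_last_col T in
  let TO := sparsify Omega Tm in
  eta^-1 *: block_mx (diag_mx (T *m (const_mx 1 : 'cV[R]_m))^T) TO
                     TO^T (diag_mx (Tm^T *m (const_mx 1 : 'cV[R]_n))^T).

Definition lowrank (R : realType) (p : nat) (A : 'M[R]_p) (s y : 'cV[R]_p) :
    'M[R]_p :=
  if 10 ^- 6 * enorm y ^+ 2 < dot y s then
    let u := y in
    let v := A *m s in
    let xi := (dot y s)^-1 in
    let zeta := - (dot v s)^-1 in
    xi *: (u *m u^T) + zeta *: (v *m v^T)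
  else 0.

Definition wolfe (R : realType) (p : nat) (F : 'cV[R]_p -> R) (c1 c2 : R)
    (x d : 'cV[R]_p) (gamma : R) : Prop :=
  F (x + gamma *: d) <= F x + c1 * gamma * dot (gradient F x) d /\
  c2 * dot (gradient F x) d <= dot (gradient F (x + gamma *: d)) d.

Definition splr_direction (R : realType) (n m : nat) (M : 'M[R]_(n, m))
    (a : 'cV[R]_n) (b : 'cV[R]_m) (eta taumax : R)
    (Omega : {set 'I_n * 'I_m.-1}) (xm x : 'cV[R]_(n + m.-1)) :
    'cV[R]_(n + m.-1) :=
  let f := ot_dual M a b eta in
  let g := gradient f x in
  let s := x - xm in
  let y := g - gradient f xm in
  let tau := Num.min taumax (enorm g) in
  let H := H_sparse M eta Omega x in
  let B := H + lowrank (H + tau%:M) s y + tau%:M in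
  - (invmx B *m g).

(* A relation, since Omega and the step size gamma are free choices:
   xp is a possible output from previous iterate xm and current iterate x. *)
Definition splr_step (R : realType) (n m : nat) (M : 'M[R]_(n, m))
    (a : 'cV[R]_n) (b : 'cV[R]_m) (eta taumax c1 c2 : R)
    (xm x xp : 'cV[R]_(n + m.-1)) : Prop :=
  exists (Omega : {set 'I_n * 'I_m.-1}) (gamma : R),
    let d := splr_direction M a b eta taumax Omega xm x in
    [/\ Omega_star n m.-1 \subset Omega,
        0 < gamma,
        wolfe (ot_dual M a b eta) c1 c2 x d gamma
      & xp = x + gamma *: d].

(* The iterate x_(k-2) used as previous iterate when computing x_k (k >= 1);
   xinit plays the role of x_(-1). *)
Definition prev_iterate (V : Type) (xinit : V) (x : nat -> V) (k : nat) : V :=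
  if (k <= 1)%N then xinit else x (k - 2)%N.

(* Main.v *)
(* Writing [p_ij = alpha_i + beta_j], the marginal constraints turn [f] into
   [sum_ij eta exp((p_ij - M_ij) / eta) - a_i b_j p_ij]. Each summand is
   coercive, so the plan is bounded above and below on a level set of [f], here
   one containing [x_0] and the arbitrary previous iterate of the first step.
   Applying scalar inequalities for [exp] to each [p_ij] then gives uniform
   curvature and Lipschitz bounds for the gradient and bounds
   [f - f* <= const |grad f|^2], with no Hessian and no minimiser of [f].
   Since [Omega] contains the first row, [H_Omega] is uniformly positive
   definite, and the curvature bound keeps the BFGS-type rank-two update
   uniformly well conditioned. A Wolfe step along such a direction
   decreases [f] by at least [const |grad f|^2], hence contracts [f - f*]; all
   iterates stay in the level set because [f] never increases. *)
Require Import Defs.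
From HB Require Import structures.
From mathcomp Require Import all_boot all_order all_algebra.
From mathcomp Require Import all_classical all_reals all_analysis.
From mathcomp Require Import ring lra.
Import Order.TTheory GRing.Theory Num.Theory.
Import numFieldNormedType.Exports.
Local Open Scope classical_set_scope.
Local Open Scope ring_scope.

Set Implicit Arguments.
Unset Strict Implicit.
Unset Printing Implicit Defensive.

(** * The Euclidean inner product *)

Lemma dotE (R : realType) (p : nat) (u v : 'cV[R]_p) :
  dot u v = \sum_i u i 0 * v i 0.
Proof. by rewrite /dot mxE; apply: eq_bigr => i _; rewrite mxE. Qed.

Lemma dotC (R : realType) (p : nat) (u v : 'cV[R]_p) : dot u v = dot v u.
Proof. by rewrite !dotE; apply: eq_bigr => i _; rewrite mulrC. Qed.

Lemma dot0r (R : realType) (p : nat) (u : 'cV[R]_p) : dot u 0 = 0.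
Proof. by rewrite /dot mulmx0 mxE. Qed.

Lemma dotDr (R : realType) (p : nat) (u v w : 'cV[R]_p) :
  dot u (v + w) = dot u v + dot u w.
Proof. by rewrite /dot mulmxDr mxE. Qed.

Lemma dotZr (R : realType) (p : nat) (c : R) (u v : 'cV[R]_p) :
  dot u (c *: v) = c * dot u v.
Proof. by rewrite /dot -scalemxAr mxE. Qed.

Lemma dotNr (R : realType) (p : nat) (u v : 'cV[R]_p) :
  dot u (- v) = - dot u v.
Proof. by rewrite /dot mulmxN mxE. Qed.

Lemma dotDl (R : realType) (p : nat) (u v w : 'cV[R]_p) :
  dot (v + w) u = dot v u + dot w u.
Proof. by rewrite dotC dotDr !(dotC u). Qed.

Lemma dotZl (R : realType) (p : nat) (c : R) (u v : 'cV[R]_p) :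
  dot (c *: v) u = c * dot v u.
Proof. by rewrite dotC dotZr (dotC u). Qed.

Lemma dotNl (R : realType) (p : nat) (u v : 'cV[R]_p) :
  dot (- v) u = - dot v u.
Proof. by rewrite dotC dotNr (dotC u). Qed.

Lemma dot_ge0 (R : realType) (p : nat) (u : 'cV[R]_p) : 0 <= dot u u.
Proof. by rewrite dotE sumr_ge0// => i _; rewrite -expr2 sqr_ge0. Qed.

Lemma dot_eq0 (R : realType) (p : nat) (u : 'cV[R]_p) :
  dot u u = 0 -> u = 0.
Proof.
rewrite dotE => /eqP; rewrite psumr_eq0 => [/allP u0|i _]; last first.
  by rewrite -expr2 sqr_ge0.
apply/matrixP => i j; rewrite (ord1 j) mxE.
by have := u0 i (mem_index_enum _); rewrite /= mulf_eq0 orbb => /eqP.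
Qed.

Lemma sqr_enorm (R : realType) (p : nat) (u : 'cV[R]_p) :
  enorm u ^+ 2 = dot u u.
Proof. by rewrite sqr_sqrtr// dot_ge0. Qed.

(** * Positive semidefinite forms and the rank-two update *)

Lemma dot_mulmxC (R : realType) (p : nat) (A : 'M[R]_p) (u v : 'cV[R]_p) :
  A^T = A -> dot u (A *m v) = dot v (A *m u).
Proof. by move=> sA; rewrite dotC /dot trmx_mul sA mulmxA. Qed.

Lemma dot_outer (R : realType) (p : nat) (u v w : 'cV[R]_p) :
  dot v ((u *m u^T) *m w) = dot u v * dot u w.
Proof.
rewrite -mulmxA [u^T *m w]mx11_scalar -[(_ *m w) 0 0]/(dot u w).
by rewrite mul_mx_scalar dotZr mulrC (dotC v).
Qed.

(** The form is nonnegative at [u + t v] for every [t], and a nonnegative quadratic polynomial in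
    [t] has nonpositive discriminant. *)
Lemma psd_cauchy_schwarz (R : realType) (p : nat) (B : 'M[R]_p)
    (u v : 'cV[R]_p) :
  B^T = B -> (forall w, 0 <= dot w (B *m w)) ->
  dot u (B *m v) ^+ 2 <= dot u (B *m u) * dot v (B *m v).
Proof.
move=> sB B0.
have poly t : 0 <= dot u (B *m u) + 2 * t * dot u (B *m v)
                   + t ^+ 2 * dot v (B *m v).
  have := B0 (u + t *: v).
  rewrite mulmxDr -scalemxAr dotDl !dotDr !dotZl !dotZr (dot_mulmxC v u sB).
  set X := dot u _; set Y := dot u _; set Z := dot v _ => /le_trans; apply.
  by rewrite le_eqVlt; apply/orP; left; apply/eqP; ring.
set X := dot u (B *m u) in poly *; set Y := dot u (B *m v) in poly *.
set Z := dot v (B *m v) in poly *.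
have : 0 <= Z by apply: B0.
rewrite le_eqVlt => /orP[/eqP Z0|Z0].
  have [->|Yn0] := eqVneq Y 0; first by rewrite expr2 mul0r -Z0 mulr0.
  (* With [Z = 0] the polynomial is affine, and this [t] gives it the value [-1]. *)
  have := poly (- (X + 1) / (2 * Y)).
  have -> : X + 2 * (- (X + 1) / (2 * Y)) * Y
            + (- (X + 1) / (2 * Y)) ^+ 2 * Z = -1.
    by rewrite -Z0 mulr0; field.
  lra.
have := poly (- Y / Z).
have -> : X + 2 * (- Y / Z) * Y + (- Y / Z) ^+ 2 * Z = (X * Z - Y ^+ 2) / Z.
  by field; rewrite gt_eqF.
by rewrite pmulr_lge0 ?invr_gt0// subr_ge0.
Qed.

Lemma dot_cauchy_schwarz (R : realType) (p : nat) (u v : 'cV[R]_p) :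
  dot u v ^+ 2 <= dot u u * dot v v.
Proof.
have := @psd_cauchy_schwarz R p 1%:M u v (trmx1 _ _).
by rewrite !mul1mx; apply => w; rewrite mul1mx dot_ge0.
Qed.

(** With [z = B w], Cauchy-Schwarz reads [|z|^4 <= z'Bz w'Bw <= Lam |z|^2 w'Bw]; divide by
    [|z|^2]. *)
Lemma psd_image_bound (R : realType) (p : nat) (B : 'M[R]_p) (Lam : R) :
  B^T = B -> (forall w, 0 <= dot w (B *m w)) ->
  (forall w, dot w (B *m w) <= Lam * dot w w) ->
  forall w, dot (B *m w) (B *m w) <= Lam * dot w (B *m w).
Proof.
move=> sB B0 BL w; set z := B *m w.
have := dot_ge0 z; rewrite le_eqVlt => /orP[/eqP z0|z0].
  by rewrite (dot_eq0 (esym z0)) !dot0r mulr0.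
have := psd_cauchy_schwarz z w sB B0; rewrite -/z => CS.
have : dot z z ^+ 2 <= dot z z * (Lam * dot w z).
  apply: (le_trans CS); rewrite mulrA (mulrC _ Lam).
  by rewrite ler_wpM2r// /z B0.
by rewrite expr2 ler_pM2l.
Qed.

Lemma posdef_unitmx (R : realType) (p : nat) (B : 'M[R]_p) (lam : R) :
  0 < lam -> B^T = B -> (forall w, lam * dot w w <= dot w (B *m w)) ->
  B \in unitmx.
Proof.
move=> lam0 sB Bl; rewrite -row_free_unit; apply: inj_row_free => v vB.
have Bv : B *m v^T = 0 by rewrite -sB -trmx_mul vB trmx0.
have := Bl v^T; rewrite Bv dot0r pmulr_rle0// => v0.
have /dot_eq0 : dot v^T v^T = 0 by apply/eqP; rewrite eq_le v0 dot_ge0.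
by move=> /(congr1 trmx); rewrite trmxK trmx0.
Qed.

(* With [t = v'As / s'As] and [w = v - t s], the rank-two update has quadratic
   form [w'Aw + (y'v)^2 / y's]; the first term controls [w], and since
   [t y's = y'v - y'w] both terms together control [t]. *)
Lemma lowrank_bounds (R : realType) (p : nat) (A : 'M[R]_p) (s y : 'cV[R]_p)
    (lam Lam mu : R) :
  0 < lam -> 0 < mu -> A^T = A ->
  (forall w, lam * dot w w <= dot w (A *m w)) ->
  (forall w, dot w (A *m w) <= Lam * dot w w) ->
  mu * dot s s <= dot y s ->
  let B := A + lowrank A s y in
  [/\ B^T = B,
     forall w, dot w w <=
       (2 / lam + 4 * 10 ^+ 6 / (mu * lam) + 4 / mu) * dot w (B *m w)
   & forall w, dot w (B *m w) <= (Lam + 10 ^+ 6) * dot w w].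
Proof.
move=> lam0 mu0 sA Al AL smu.
have c0 : 0 <= 4 * 10 ^+ 6 / (mu * lam) + 4 / mu.
  by rewrite addr_ge0// divr_ge0// ?mulr_ge0// ?exprn_ge0// ltW.
(* If the update is skipped, [B = A], and the bounds on [A] are weakened to the common constants. *)
rewrite /lowrank sqr_enorm; case: ifPn => [ys|_] /=; last first.
  rewrite addr0; split => // w.
    have A0 : 0 <= dot w (A *m w).
      by apply: le_trans (Al w); rewrite mulr_ge0 ?dot_ge0// ltW.
    apply: (@le_trans _ _ (2 / lam * dot w (A *m w))).
      apply: (@le_trans _ _ (lam^-1 * dot w (A *m w))).
        by rewrite ler_pdivlMl.
      by rewrite ler_wpM2r// ler_peMl ?invr_ge0 ?ler1n// ltW.
    by rewrite -addrA [leRHS]mulrDl lerDl mulr_ge0.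
  by apply: le_trans (AL w) _; rewrite mulrDl lerDl mulr_ge0 ?dot_ge0.
have yy := dot_ge0 y.
have ys0 : 0 < dot y s.
  by apply: le_lt_trans ys; rewrite mulr_ge0// invr_ge0.
have sn0 : s != 0.
  by apply: contraTneq ys0 => ->; rewrite dot0r ltxx.
have ss0 : 0 < dot s s.
  rewrite lt_def dot_ge0 andbT; apply: contra_neq sn0; exact: dot_eq0.
set v := A *m s.
have sAs0 : 0 < dot s v by apply: lt_le_trans (Al s); rewrite mulr_gt0.
(* The acceptance test of the update is what bounds the norm of [yy' / y's] by [10^6]. *)
have yyb : dot y y <= 10 ^+ 6 * dot y s.
  by move/ltW: ys; rewrite ler_pdivrMl ?exprn_gt0.
have formB w : dot w ((A + ((dot y s)^-1 *: (y *m y^T)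
                 + - (dot v s)^-1 *: (v *m v^T))) *m w)
   = dot w (A *m w) - dot w v ^+ 2 / dot s v + dot y w ^+ 2 / dot y s.
  rewrite !mulmxDl -!scalemxAl !dotDr !dotZr !dot_outer (dotC v s) (dotC v w).
  by ring.
split.
- by rewrite !linearD/= !linearZ/= !trmx_mul !trmxK sA.
- move=> w; rewrite formB.
  set t := dot w v / dot s v; have [z zE] : exists z, z = w - t *: s by eexists.
  have -> : dot w (A *m w) - dot w v ^+ 2 / dot s v = dot z (A *m z).
    rewrite zE mulmxDr mulmxN -scalemxAr -/v.
    rewrite !(dotDl, dotDr, dotNl, dotNr, dotZl, dotZr)
      (dot_mulmxC s w sA) -/v /t.
    by field; rewrite gt_eqF.
  have zA := Al z.
  have wE : dot w w = dot z z + 2 * t * dot z s + t ^+ 2 * dot s s.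
    have -> : w = z + t *: s by rewrite zE subrK.
    by rewrite !(dotDl, dotDr, dotZl, dotZr) (dotC s z); ring.
  have sz : 2 * t * dot z s <= dot z z + t ^+ 2 * dot s s.
    have := dot_ge0 (z - t *: s).
    by rewrite !(dotDl, dotDr, dotNl, dotNr, dotZl, dotZr) (dotC s z); lra.
  have yt : t * dot y s = dot y w - dot y z.
    by rewrite zE dotDr dotNr dotZr; ring.
  have yz : dot y z ^+ 2 <= 10 ^+ 6 * dot z z * dot y s.
    apply: le_trans (dot_cauchy_schwarz _ _) _.
    by rewrite mulrAC ler_wpM2r// dot_ge0.
  have E0 : 0 <= dot y w ^+ 2 / dot y s by rewrite divr_ge0 ?sqr_ge0// ltW.
  set E := dot y w ^+ 2 / dot y s in E0 *.
  have EE : dot y w ^+ 2 = E * dot y s by rewrite /E divfK ?gt_eqF.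
  have tys : t ^+ 2 * dot y s <= 2 * E + 2 * 10 ^+ 6 * dot z z.
    rewrite -(ler_pM2r ys0).
    have -> : t ^+ 2 * dot y s * dot y s = (dot y w - dot y z) ^+ 2.
      by rewrite -yt; ring.
    apply: (@le_trans _ _ (2 * (dot y w) ^+ 2 + 2 * dot y z ^+ 2)).
      by have := sqr_ge0 (dot y w + dot y z); lra.
    by rewrite EE; lra.
  have tss : t ^+ 2 * dot s s <= mu^-1 * (2 * E + 2 * 10 ^+ 6 * dot z z).
    rewrite ler_pdivlMl//; apply: le_trans tys.
    by rewrite mulrCA ler_wpM2l// sqr_ge0.
  have zz : dot z z <= lam^-1 * dot z (A *m z) by rewrite ler_pdivlMl.
  have mu' : 0 < mu^-1 by rewrite invr_gt0.
  have lam' : 0 < lam^-1 by rewrite invr_gt0.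
  (* The first two summands on the right bound [2 z'z + 2 t^2 s's], hence [w'w]; the rest is a
     surplus, nonnegative by [r0]. *)
  have -> : (2 / lam + 4 * 10 ^+ 6 / (mu * lam) + 4 / mu)
      * (dot z (A *m z) + E)
    = 2 * (lam^-1 * dot z (A *m z)) + 2 * (mu^-1 * (2 * E
         + 2 * 10 ^+ 6 * (lam^-1 * dot z (A *m z))))
       + (2 * (lam^-1 * E) + 4 * 10 ^+ 6 * (mu^-1 * lam^-1 * E)
          + 4 * (mu^-1 * dot z (A *m z))).
    by field; rewrite !gt_eqF.
  have r0 : 0 <= 2 * (lam^-1 * E) + 4 * 10 ^+ 6 * (mu^-1 * lam^-1 * E)
          + 4 * (mu^-1 * dot z (A *m z)).
    have zA0 : 0 <= dot z (A *m z).
      by apply: le_trans zA; rewrite mulr_ge0 ?dot_ge0// ltW.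
    have h1 : 0 <= lam^-1 * E by rewrite mulr_ge0// ltW.
    have h2 : 0 <= mu^-1 * lam^-1 * E.
      by rewrite mulr_ge0// ltW// mulr_gt0.
    have h3 : 0 <= mu^-1 * dot z (A *m z) by rewrite mulr_ge0// ltW.
    by rewrite !addr_ge0// mulr_ge0// mulr_ge0// exprn_ge0.
  have h : mu^-1 * (2 * E + 2 * 10 ^+ 6 * dot z z) <=
     mu^-1 * (2 * E + 2 * 10 ^+ 6 * (lam^-1 * dot z (A *m z))).
    by rewrite ler_pM2l// lerD2l ler_pM2l// mulr_gt0// exprn_gt0.
  rewrite wE; move: sz tss zz h r0.
  set q1 := mu^-1 * _; set q2 := mu^-1 * _; set q3 := lam^-1 * _.
  set q4 := (_ + _ + 4 * _).
  by lra.
- move=> w; rewrite formB mulrDl; apply: lerD.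
    apply: le_trans (AL w); rewrite lerBlDr lerDl.
    by rewrite divr_ge0 ?sqr_ge0// ltW.
  rewrite ler_pdivrMr//; apply: le_trans (dot_cauchy_schwarz _ _) _.
  by rewrite mulrAC ler_wpM2r// dot_ge0.
Qed.

(** * Scalar inequalities for the exponential *)

(** For [t >= 0], [exp t >= (1 + t/2)^2 >= 2 t >= 2 c t]; for [t < 0] the linear term alone
    suffices. *)
Lemma expR_sub_lin_ge (R : realType) (c t : R) :
  0 <= c <= 1 -> c * `|t| <= expR t - c * t.
Proof.
move=> /andP[c0 c1]; have [t0|t0] := ger0P t; last first.
  by have := expR_ge0 t; lra.
have h1 := expR_ge1Dx (t / 2).
have -> : expR t = expR (t / 2) ^+ 2.
  by rewrite expr2 -expRD; congr expR; field.
have : (1 + t / 2) ^+ 2 <= expR (t / 2) ^+ 2.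
  by rewrite ler_pXn2r// nnegrE ?expR_ge0//; lra.
have : c * t <= t by rewrite ler_piMl.
by have := sqr_ge0 (1 - t / 2); lra.
Qed.

Lemma expR_tangent_le (R : realType) (s t : R) :
  expR s * (t - s) <= expR t - expR s.
Proof.
have -> : expR t = expR s * expR (t - s).
  by rewrite -expRD; congr expR; ring.
have := expR_ge1Dx (t - s); rewrite -(ler_pM2l (expR_gt0 s)).
by rewrite mulrDr mulr1; lra.
Qed.

(** Once [s <= t] by symmetry, the tangent at [s] has slope at least [l]. *)
Lemma expR_diff_lb (R : realType) (l s t : R) :
  l <= expR s -> l <= expR t ->
  l * (t - s) ^+ 2 <= (expR t - expR s) * (t - s).
Proof.
wlog st : s t / s <= t => [wl ls lt|].
  have [st|/ltW ts] := lerP s t; first exact: wl.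
  by have := wl t s ts lt ls; lra.
move=> ls _; rewrite expr2 mulrA ler_wpM2r ?subr_ge0//.
apply: le_trans (expR_tangent_le s t).
by rewrite ler_wpM2r ?subr_ge0.
Qed.

Lemma expR_diff_ub (R : realType) (u s t : R) :
  expR s <= u -> expR t <= u ->
  (expR t - expR s) * (t - s) <= u * (t - s) ^+ 2.
Proof.
wlog st : s t / s <= t => [wl us ut|].
  have [st|/ltW ts] := lerP s t; first exact: wl.
  by have := wl t s ts ut us; lra.
move=> _ ut; rewrite expr2 mulrA ler_wpM2r ?subr_ge0//.
apply: (@le_trans _ _ (expR t * (t - s))); last first.
  by rewrite ler_wpM2r ?subr_ge0.
by have := expR_tangent_le t s; lra.
Qed.

(** An explicit Taylor remainder: for [s <= t], squaring [1 + h <= exp h] at [h = (t - s)/2] gives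
    [exp (2h) >= 1 + 2h + h^2], whence the factor [1/4]. *)
Lemma expR_bregman_lb (R : realType) (l s t : R) :
  l <= expR s -> l <= expR t ->
  l / 4 * (t - s) ^+ 2 <= expR t - expR s - expR s * (t - s).
Proof.
move=> ls lt; have [st|ts] := lerP s t.
  have tE : expR t = expR s * expR ((t - s) / 2) ^+ 2.
    by rewrite expr2 -!expRD; congr expR; field.
  have h : (1 + (t - s) / 2) ^+ 2 <= expR ((t - s) / 2) ^+ 2.
    rewrite ler_pXn2r// ?expR_ge1Dx// nnegrE ?expR_ge0//; lra.
  have := ler_wpM2l (expR_ge0 s) h; rewrite -tE => h'.
  have := ler_wpM2r (sqr_ge0 (t - s)) ls; lra.
(* with d = s - t, this reads 1 - e^d (1 - d) >= d^2 / 4 *)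
have sE : expR s = expR t * expR (s - t).
  by rewrite -expRD; congr expR; ring.
suff : 1 / 4 * (s - t) ^+ 2 <= 1 - expR (s - t) * (1 - (s - t)).
  move=> h; have h1 := ler_wpM2l (expR_ge0 t) h.
  have h2 := ler_wpM2r (sqr_ge0 (t - s)) lt.
  have : expR t * (1 - expR (s - t) * (1 - (s - t)))
         = expR t - expR s - expR s * (t - s) by rewrite sE; ring.
  by lra.
set d := s - t; have d0 : 0 < d by rewrite /d; lra.
have ed := expR_ge1Dx d.
(* For [d > 2], [exp d >= 1 + d] already gives [exp d (d - 1) >= d^2 - 1]. For [d <= 2] the base
   [1 - d/2] is nonnegative, so it may be squared; multiplying by [exp d] then yields
   [1 - exp d (1 - d) >= exp d d^2 / 4]. *)
have [d2|d2] := lerP d 2; last first.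
  have : (1 + d) * (d - 1) <= expR d * (d - 1).
    by rewrite ler_wpM2r//; lra.
  by have := sqr_ge0 d; lra.
have h : (1 - d / 2) ^+ 2 <= expR (- d).
  have -> : expR (- d) = expR (- (d / 2)) ^+ 2.
    by rewrite expr2 -!expRD; congr expR; field.
  rewrite ler_pXn2r// ?nnegrE ?expR_ge0//; last by lra.
  by have := expR_ge1Dx (- (d / 2)); lra.
have := ler_wpM2l (expR_ge0 d) h; rewrite expRxMexpNx_1 => h'.
have : d ^+ 2 <= expR d * d ^+ 2.
  by rewrite ler_peMl ?sqr_ge0//; lra.
by lra.
Qed.

(** * Potentials, the dual objective and its gradient *)

Lemma alpha_ofP (R : realType) (n m : nat) (c : R) (x y : 'cV[R]_(n + m.-1)) i :
  alpha_of (c *: x + y) i 0 = c * alpha_of x i 0 + alpha_of y i 0.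
Proof. by rewrite /alpha_of !mxE. Qed.

Lemma beta_ofP (R : realType) (n m : nat) (c : R) (x y : 'cV[R]_(n + m.-1)) j :
  beta_of (c *: x + y) j 0 = c * beta_of x j 0 + beta_of y j 0.
Proof.
rewrite /beta_of !mxE; case: insub => [k|]/=; first by rewrite !mxE.
by rewrite mulr0 addr0.
Qed.

(** The [p_ij]: linear in [x], they are the coordinates in which the objective separates. *)
Definition pot (R : realType) (n m : nat) (x : 'cV[R]_(n + m.-1)) i j : R :=
  alpha_of x i 0 + @beta_of R n m x j 0.

Lemma potP (R : realType) (n m : nat) (c : R) (x y : 'cV[R]_(n + m.-1)) i j :
  @pot R n m (c *: x + y) i j = c * pot x i j + pot y i j.
Proof. by rewrite /pot alpha_ofP beta_ofP; ring. Qed.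

Lemma pot0 (R : realType) (n m : nat) i j :
  @pot R n m 0 i j = 0.
Proof.
have := potP (-1) (0 : 'cV[R]_(n + m.-1)) 0 i j.
by rewrite scaler0 addr0; lra.
Qed.

Lemma potB (R : realType) (n m : nat) (x y : 'cV[R]_(n + m.-1)) i j :
  @pot R n m (x - y) i j = pot x i j - pot y i j.
Proof. by rewrite addrC -scaleN1r potP; ring. Qed.

Lemma pot_delta (R : realType) (n m : nat) (x : 'cV[R]_(n + m.-1)) i j :
  @pot R n m x i j = \sum_k x k 0 * @pot R n m (delta_mx k 0) i j.
Proof.
have {1}-> : x = \sum_k x k 0 *: delta_mx k 0.
  rewrite {1}(matrix_sum_delta x); apply: eq_bigr => k _.
  by rewrite big_ord1.
apply: (big_rec2 (fun v s => pot v i j = s)); first exact: pot0.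
by move=> k s v _ <-; rewrite potP.
Qed.

Lemma planE (R : realType) (n m : nat) (M : 'M[R]_(n, m)) (eta : R)
    (x : 'cV[R]_(n + m.-1)) i j :
  plan M eta x i j = expR ((pot x i j - M i j) / eta).
Proof. by rewrite /plan mxE. Qed.

(** As [a] and [b] sum to 1, [alpha'a + beta'b] equals the sum of [a_i b_j (alpha_i + beta_j)]. *)
Lemma ot_dualE (R : realType) (n m : nat) (M : 'M[R]_(n, m)) (a : 'cV[R]_n)
    (b : 'cV[R]_m) (eta : R) (x : 'cV[R]_(n + m.-1)) :
  \sum_i a i 0 = 1 -> \sum_j b j 0 = 1 ->
  ot_dual M a b eta x =
  \sum_i \sum_j (eta * plan M eta x i j - a i 0 * b j 0 * pot x i j).
Proof.
move=> a1 b1; under eq_bigr do rewrite sumrB.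
rewrite sumrB /ot_dual -addrA -opprD; congr (_ - _).
  rewrite mulr_sumr; apply: eq_bigr => i _; rewrite mulr_sumr.
  by apply: eq_bigr => j _; rewrite planE (mulrC eta^-1).
under eq_bigr do under eq_bigr do rewrite /pot mulrDr.
under eq_bigr do rewrite big_split/=.
rewrite big_split/= !dotE; congr (_ + _).
  apply: eq_bigr => i _; rewrite -mulr_suml -mulr_sumr b1 mulr1.
  by rewrite mulrC.
rewrite exchange_big/=; apply: eq_bigr => j _.
by rewrite -2!mulr_suml a1 mul1r mulrC.
Qed.

Lemma ot_dual_derive (R : realType) (n m : nat) (M : 'M[R]_(n, m))
    (a : 'cV[R]_n) (b : 'cV[R]_m) (eta : R) (x v : 'cV[R]_(n + m.-1)) :
  eta != 0 -> \sum_i a i 0 = 1 -> \sum_j b j 0 = 1 ->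
  'D_v (ot_dual M a b eta) x =
  \sum_i \sum_j (plan M eta x i j - a i 0 * b j 0) * pot v i j.
Proof.
move=> eta0 a1 b1.
pose phi i j (h : R) : R :=
  eta * expR ((h * pot v i j + pot x i j - M i j) / eta)
   - a i 0 * b j 0 * (h * pot v i j + pot x i j).
have E k : ot_dual M a b eta (k *: v + x)
          = (\sum_(i < n) \sum_(j < m) phi i j) k.
  rewrite ot_dualE// fct_sumE; apply: eq_bigr => i _.
  rewrite fct_sumE; apply: eq_bigr => j _.
  by rewrite planE potP.
(* A directional derivative only sees the restriction to the line [h v + x], so it is the derivative
   at 0 of a finite sum of one-variable functions. *)
have -> : 'D_v (ot_dual M a b eta) x =
    'D_(1 : R) (\sum_(i < n) \sum_(j < m) phi i j) 0.
  rewrite /derive; apply: (congr1 (fun g : R -> R => lim (g @ 0^'))).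
  apply/funext => h /=.
  rewrite E addr0 [h%:A]mulr1; congr (_ *: (_ - _)).
  by rewrite -{1}[x]add0r -(scale0r v) E.
suff H : is_derive (0 : R) (1 : R) (\sum_(i < n) \sum_(j < m) phi i j)
    (\sum_i \sum_j (plan M eta x i j - a i 0 * b j 0) * pot v i j).
  exact: (@derive_val _ _ _ _ _ _ _ H).
apply: is_derive_sum => i; apply: is_derive_sum => j.
rewrite planE /phi.
set q := pot v i j; set p := pot x i j; set c := a i 0 * b j 0.
have lin : is_derive (0 : R) (1 : R) (fun h : R => h * q + p) q.
  by apply: is_derive_eq; rewrite scaler0 [q%:A]mulr1 add0r addr0.
have aff : is_derive (0 : R) (1 : R)
    (fun h : R => (h * q + p - M i j) / eta) (q / eta).
  by apply: is_derive_eq; rewrite scaler0 add0r subr0 [LHS]mulrC.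
have := @is_derive1_comp _ expR (fun h : R => (h * q + p - M i j) / eta) 0 _ _
  (is_derive_expR _) aff.
rewrite /= mul0r add0r => ex.
apply: is_derive_eq; rewrite /= /GRing.scale/= ?scaler0.
by field.
Qed.

(** The formula for directional derivatives is linear in the direction, so expanding [v] in the
    canonical basis turns partial derivatives into the full pairing. *)
Lemma dot_gradient (R : realType) (n m : nat) (M : 'M[R]_(n, m))
    (a : 'cV[R]_n) (b : 'cV[R]_m) (eta : R) (x v : 'cV[R]_(n + m.-1)) :
  eta != 0 -> \sum_i a i 0 = 1 -> \sum_j b j 0 = 1 ->
  dot (gradient (ot_dual M a b eta) x) v =
  \sum_i \sum_j (plan M eta x i j - a i 0 * b j 0) * pot v i j.
Proof.
move=> eta0 a1 b1; rewrite dotE.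
under eq_bigr do rewrite mxE ot_dual_derive// mulr_suml.
rewrite exchange_big/=; apply: eq_bigr => i _.
under eq_bigr do rewrite mulr_suml.
rewrite exchange_big/=; apply: eq_bigr => j _.
rewrite (pot_delta v) mulr_sumr; apply: eq_bigr => k _.
by rewrite -mulrA (mulrC (v k 0)).
Qed.

(** * Coercivity and bounds on level sets *)

Lemma weight_le1 (R : realType) (n : nat) (a : 'cV[R]_n) i :
  (forall i, 0 < a i 0) -> \sum_i a i 0 = 1 -> a i 0 <= 1.
Proof.
move=> a0 <-; rewrite (bigD1 i)//= lerDl sumr_ge0// => k _; exact: ltW.
Qed.

(** With [t = (p_ij - M_ij) / eta] and [c = a_i b_j <= 1], each summand is
    [eta (exp t - c t) - c M_ij]. *)
Lemma ot_dual_coercive (R : realType) (n m : nat) (M : 'M[R]_(n, m))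
    (a : 'cV[R]_n) (b : 'cV[R]_m) (eta : R) (x : 'cV[R]_(n + m.-1)) :
  0 < eta -> (forall i, 0 < a i 0) -> (forall j, 0 < b j 0) ->
  \sum_i a i 0 = 1 -> \sum_j b j 0 = 1 ->
  \sum_i \sum_j (eta * (a i 0 * b j 0) * `|(pot x i j - M i j) / eta|
                 - a i 0 * b j 0 * M i j)
    <= ot_dual M a b eta x.
Proof.
move=> eta0 a0 b0 a1 b1; rewrite ot_dualE//.
apply: ler_sum => i _; apply: ler_sum => j _; rewrite planE.
set t := (_ / eta); set c := a i 0 * b j 0.
have c01 : 0 <= c <= 1.
  have ai := ltW (a0 i); have bj := ltW (b0 j).
  by rewrite mulr_ge0//= mulr_ile1// weight_le1.
have := ler_wpM2l (ltW eta0) (expR_sub_lin_ge t c01).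
have -> : pot x i j = eta * t + M i j by rewrite /t; field; rewrite gt_eqF.
by lra.
Qed.

(** Dropping the absolute values from the coercive bound leaves a constant; hence [inf (range f)] is
    a genuine lower bound of [f]. *)
Lemma ot_dual_bounded_below (R : realType) (n m : nat) (M : 'M[R]_(n, m))
    (a : 'cV[R]_n) (b : 'cV[R]_m) (eta : R) :
  0 < eta -> (forall i, 0 < a i 0) -> (forall j, 0 < b j 0) ->
  \sum_i a i 0 = 1 -> \sum_j b j 0 = 1 ->
  has_lbound (range (ot_dual M a b eta)).
Proof.
move=> eta0 a0 b0 a1 b1.
exists (\sum_i \sum_j (- (a i 0 * b j 0 * M i j))) => _ [x _ <-].
apply: le_trans (ot_dual_coercive _ _ _ _ _ _ _) => //.
apply: ler_sum => i _; apply: ler_sum => j _.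
by rewrite lerDr !mulr_ge0// ltW.
Qed.

(** On the level set the nonnegative terms [w_ij |t_ij|], with [t_ij] the exponent of the plan, sum
    to at most [K], so each [|t_ij|] is at most [K / w_ij]. *)
Lemma level_set_plan_bounds (R : realType) (n m : nat) (M : 'M[R]_(n, m))
    (a : 'cV[R]_n) (b : 'cV[R]_m) (eta F : R) :
  0 < eta -> (forall i, 0 < a i 0) -> (forall j, 0 < b j 0) ->
  \sum_i a i 0 = 1 -> \sum_j b j 0 = 1 ->
  exists tl tu : R, [/\ 0 < tl, 0 < tu &
    forall x, ot_dual M a b eta x <= F ->
      forall i j, tl <= plan M eta x i j <= tu].
Proof.
move=> eta0 a0 b0 a1 b1.
pose w i j := eta * (a i 0 * b j 0).
have w0 i j : 0 < w i j by rewrite !mulr_gt0.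
pose K := F + \sum_i \sum_j a i 0 * b j 0 * M i j.
(* Summing over all indices gives a bound uniform in [(i, j)]. *)
pose Q := \sum_i \sum_j `|K / w i j|.
exists (expR (- Q)), (expR Q); split; rewrite ?expR_gt0// => x xF i j.
rewrite planE !ler_expR -ler_norml.
apply: (@le_trans _ _ (`|K / w i j|)); last first.
  rewrite /Q (bigD1 i)//= (bigD1 j)//= -addrA lerDl addr_ge0//.
    by rewrite sumr_ge0.
  by rewrite sumr_ge0// => k _; rewrite sumr_ge0.
apply: le_trans (ler_norm _); rewrite ler_pdivlMr// mulrC.
have := le_trans (ot_dual_coercive M x eta0 a0 b0 a1 b1) xF.
under eq_bigr do rewrite sumrB.
rewrite sumrB lerBlDr -/K; apply: le_trans.
rewrite (bigD1 i)//= (bigD1 j)//= -/(w i j) -[leRHS]addrA lerDl addr_ge0//.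
  by rewrite sumr_ge0// => k _; rewrite mulr_ge0// ltW// w0.
rewrite sumr_ge0// => k _; rewrite sumr_ge0// => l _.
by rewrite mulr_ge0// ltW// w0.
Qed.

(** * Curvature of the objective on a level set *)

(** The weights [a_i b_j] cancel in the difference of gradients, and the secant bounds for [exp]
    apply to each entry of the plan. *)
Lemma gradient_monotone_bounds (R : realType) (n m : nat) (M : 'M[R]_(n, m))
    (a : 'cV[R]_n) (b : 'cV[R]_m) (eta tl tu : R) (x z : 'cV[R]_(n + m.-1)) :
  0 < eta -> \sum_i a i 0 = 1 -> \sum_j b j 0 = 1 ->
  (forall i j, tl <= plan M eta x i j <= tu) ->
  (forall i j, tl <= plan M eta z i j <= tu) ->
  tl / eta * \sum_i \sum_j @pot R n m (x - z) i j ^+ 2 <=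
    dot (gradient (ot_dual M a b eta) x - gradient (ot_dual M a b eta) z)
      (x - z) <= tu / eta * \sum_i \sum_j @pot R n m (x - z) i j ^+ 2.
Proof.
move=> eta0 a1 b1 bx bz; have etan0 : eta != 0 by rewrite gt_eqF.
have -> : dot (gradient (ot_dual M a b eta) x - gradient (ot_dual M a b eta) z)
      (x - z) =
    \sum_i \sum_j (plan M eta x i j - plan M eta z i j) * pot (x - z) i j.
  rewrite dotDl dotNl !dot_gradient// -sumrB; apply: eq_bigr => i _.
  by rewrite -sumrB; apply: eq_bigr => j _; ring.
have E i j : pot (x - z) i j =
    eta * ((pot x i j - M i j) / eta - (pot z i j - M i j) / eta).
  by rewrite potB; field.
rewrite !mulr_sumr; apply/andP; split; apply: ler_sum => i _;
  rewrite mulr_sumr; apply: ler_sum => j _; rewrite {}E;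
  have := bx i j; have := bz i j; rewrite !planE;
  move: ((pot z i j - _) / _) ((pot x i j - _) / _)
    => s t /andP[ls us] /andP[lt ut].
- have -> : tl / eta * (eta * (t - s)) ^+ 2 = eta * (tl * (t - s) ^+ 2).
    by field.
  by rewrite [leRHS]mulrCA ler_pM2l// expR_diff_lb.
- have -> : tu / eta * (eta * (t - s)) ^+ 2 = eta * (tu * (t - s) ^+ 2).
    by field.
  by rewrite [leLHS]mulrCA ler_pM2l// expR_diff_ub.
Qed.

(** The scalar Bregman bounds add up, the terms [a_i b_j p_ij] being linear. *)
Lemma ot_dual_strongly_convex (R : realType) (n m : nat) (M : 'M[R]_(n, m))
    (a : 'cV[R]_n) (b : 'cV[R]_m) (eta tl : R) (x z : 'cV[R]_(n + m.-1)) :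
  0 < eta -> \sum_i a i 0 = 1 -> \sum_j b j 0 = 1 ->
  (forall i j, tl <= plan M eta x i j) ->
  (forall i j, tl <= plan M eta z i j) ->
  ot_dual M a b eta x + dot (gradient (ot_dual M a b eta) x) (z - x)
    + tl / (4 * eta) * \sum_i \sum_j @pot R n m (z - x) i j ^+ 2
  <= ot_dual M a b eta z.
Proof.
move=> eta0 a1 b1 bx bz; have etan0 : eta != 0 by rewrite gt_eqF.
rewrite dot_gradient// !ot_dualE// mulr_sumr -!big_split/=.
apply: ler_sum => i _; rewrite mulr_sumr -!big_split/=.
apply: ler_sum => j _; rewrite potB.
move: (bx i j) (bz i j); rewrite !planE.
set s := (pot x i j - _) / _; set t := (pot z i j - _) / _ => ls lt.
have h := expR_bregman_lb ls lt.
have -> : pot x i j = eta * s + M i j by rewrite /s; field.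
have -> : pot z i j = eta * t + M i j by rewrite /t; field.
have -> : tl / (4 * eta) * (eta * t + M i j - (eta * s + M i j)) ^+ 2 =
   eta * (tl / 4 * (t - s) ^+ 2) by field.
by have := ler_wpM2l (ltW eta0) h; lra.
Qed.

(** * Quadratic form of the sparsified Hessian *)

(* The quadratic form of [eta H_Omega] when the plan is constantly 1. *)
Definition sqform (R : realType) (n m : nat) (Omega : {set 'I_n * 'I_m})
    (v : 'cV[R]_(n + m)) : R :=
  \sum_i (\sum_j (if (i, j) \in Omega
                  then (usubmx v i 0 + dsubmx v j 0) ^+ 2
                  else usubmx v i 0 ^+ 2 + dsubmx v j 0 ^+ 2)
          + usubmx v i 0 ^+ 2).

Lemma dot_submx (R : realType) (n m : nat) (u v : 'cV[R]_(n + m)) :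
  dot u v = dot (usubmx u) (usubmx v) + dot (dsubmx u) (dsubmx v).
Proof.
rewrite !dotE big_split_ord/=.
by congr (_ + _); apply: eq_bigr => i _; rewrite !mxE.
Qed.

Lemma sumr_ord_const (R : realType) (k : nat) (c : R) :
  \sum_(i < k) c = k%:R * c.
Proof. by rewrite sumr_const card_ord mulr_natl. Qed.

(** The isolated squares control [u]. The first row, kept by [Omega], contributes [(u_0 + w_j)^2],
    and [w_j^2 <= 2 (u_0 + w_j)^2 + 2 u_0^2] then controls [w]. *)
Lemma sqform_lb (R : realType) (n m : nat) (Omega : {set 'I_n * 'I_m})
    (v : 'cV[R]_(n + m)) :
  (0 < n)%N -> Omega_star n m \subset Omega ->
  dot v v <= 2 * m.+1%:R * sqform Omega v.
Proof.
move=> n0 sub; pose i0 := Ordinal n0.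
rewrite dot_submx !dotE; set u := usubmx v; set w := dsubmx v.
pose U := \sum_i u i 0 ^+ 2; pose W := \sum_j (u i0 0 + w j 0) ^+ 2.
have sq_ge : U + W <= sqform Omega v.
  rewrite /sqform -/u -/w big_split/= -/U [leLHS]addrC lerD2r (bigD1 i0)//=.
  rewrite (eq_bigr (fun j => (u i0 0 + w j 0) ^+ 2)) => [|j _]; last first.
    by rewrite (fintype.subsetP sub)// inE eqxx.
  rewrite lerDl; apply: sumr_ge0 => i _; apply: sumr_ge0 => j _.
  by case: ifP => _; rewrite ?addr_ge0 ?sqr_ge0.
have U0 : 0 <= U by apply: sumr_ge0 => i _; exact: sqr_ge0.
have W0 : 0 <= W by apply: sumr_ge0 => i _; exact: sqr_ge0.
have ui0 : u i0 0 ^+ 2 <= U.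
  rewrite /U (bigD1 i0)//= lerDl; apply: sumr_ge0 => i _; exact: sqr_ge0.
have ww : \sum_j w j 0 * w j 0 <= 2 * W + 2 * m%:R * U.
  have -> : 2 * m%:R * U = \sum_(j < m) 2 * U.
    by rewrite sumr_ord_const; ring.
  rewrite /W mulr_sumr -big_split/=; apply: ler_sum => j _.
  by have := sqr_ge0 (2 * u i0 0 + w j 0); lra.
have -> : \sum_i u i 0 * u i 0 = U by apply: eq_bigr => i _; rewrite expr2.
have m0 : 0 <= m%:R :> R by [].
apply: (@le_trans _ _ (2 * m.+1%:R * (U + W))); last first.
  by rewrite ler_pM2l// mulr_gt0.
rewrite -[m.+1%:R]natr1; move: (m%:R) m0 ww => k k0 ww.
by have := mulr_ge0 k0 W0; lra.
Qed.

Lemma sqform_ub (R : realType) (n m : nat) (Omega : {set 'I_n * 'I_m})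
    (v : 'cV[R]_(n + m)) :
  sqform Omega v <= 2 * (n + m.+1)%:R * dot v v.
Proof.
rewrite dot_submx !dotE; set u := usubmx v; set w := dsubmx v.
rewrite (eq_bigr (fun i => u i 0 ^+ 2)) => [|i _]; last by rewrite expr2.
rewrite [X in _ + X](eq_bigr (fun j => w j 0 ^+ 2)) => [|j _]; last first.
  by rewrite expr2.
set U := \sum_i u i 0 ^+ 2; set W := \sum_j w j 0 ^+ 2.
have U0 : 0 <= U by apply: sumr_ge0 => i _; exact: sqr_ge0.
have W0 : 0 <= W by apply: sumr_ge0 => i _; exact: sqr_ge0.
rewrite /sqform -/u -/w.
apply: (@le_trans _ _ (\sum_i (2 * m.+1%:R * u i 0 ^+ 2 + 2 * W))).
  apply: ler_sum => i _.
  apply: (@le_trans _ _ (\sum_(j < m) (2 * u i 0 ^+ 2 + 2 * w j 0 ^+ 2)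
                          + u i 0 ^+ 2)).
    rewrite lerD2r; apply: ler_sum => j _.
    have := sqr_ge0 (u i 0 - w j 0); have := sqr_ge0 (u i 0).
    by have := sqr_ge0 (w j 0); case: ifP => _; lra.
  rewrite big_split/= sumr_ord_const -mulr_sumr -[m.+1%:R]natr1 -/W.
  by have := sqr_ge0 (u i 0); lra.
rewrite big_split/= sumr_ord_const -mulr_sumr natrD -/U.
have h1 : 0 <= (n%:R : R) * U by rewrite mulr_ge0.
have h2 : 0 <= (m.+1%:R : R) * W by rewrite mulr_ge0.
by lra.
Qed.

Lemma pot_widen (R : realType) (n m : nat) (v : 'cV[R]_(n + m)) i (j : 'I_m) :
  @pot R n m.+1 v i (widen_ord (leqnSn m) j) = usubmx v i 0 + dsubmx v j 0.
Proof.
rewrite /pot /beta_of mxE; congr (_ + _).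
case: insubP => /= [k _ kj|]; last by rewrite ltn_ord.
by congr (dsubmx v _ 0); apply: val_inj.
Qed.

Lemma pot_last (R : realType) (n m : nat) (v : 'cV[R]_(n + m)) i :
  @pot R n m.+1 v i ord_max = usubmx v i 0.
Proof. by rewrite /pot /beta_of mxE insubF ?ltnn// addr0. Qed.

(** The last column, where the dual variable is pinned to 0, gives the isolated squares. The bounds
    on [sqform] thus serve both the curvature of [f] and [H_sparse]. *)
Lemma sum_sqr_pot (R : realType) (n m : nat) (v : 'cV[R]_(n + m)) :
  \sum_i \sum_j @pot R n m.+1 v i j ^+ 2 = sqform [set: 'I_n * 'I_m] v.
Proof.
apply: eq_bigr => i _; rewrite big_ord_recr/= pot_last; congr (_ + _).
by apply: eq_bigr => j _; rewrite finset.in_setT pot_widen.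
Qed.

Lemma dot_diag_mx (R : realType) (n : nat) (r u : 'cV[R]_n) :
  dot u (diag_mx r^T *m u) = \sum_i r i 0 * u i 0 ^+ 2.
Proof.
rewrite dotE; apply: eq_bigr => i _.
by rewrite mul_diag_mx !mxE; ring.
Qed.

Lemma dot_mulmx_sum (R : realType) (n m : nat) (u : 'cV[R]_n) (A : 'M[R]_(n, m))
    (w : 'cV[R]_m) :
  dot u (A *m w) = \sum_i \sum_j A i j * u i 0 * w j 0.
Proof.
rewrite dotE; apply: eq_bigr => i _; rewrite mxE mulr_sumr.
by apply: eq_bigr => j _; ring.
Qed.

(** The diagonal holds row and column sums of the plan, so entry [(i, j)] receives
    [T_ij (u_i^2 + w_j^2)]; the cross term [2 T_ij u_i w_j] is present exactly for kept entries and
    completes the square. *)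
Lemma H_sparse_form (R : realType) (n m : nat) (M : 'M[R]_(n, m.+1)) (eta : R)
    (Omega : {set 'I_n * 'I_m}) (x v : 'cV[R]_(n + m)) :
  dot v (@H_sparse R n m.+1 M eta Omega x *m v) = eta^-1 *
  \sum_i (\sum_j @plan R n m.+1 M eta x i (widen_ord (leqnSn m) j) *
                 (if (i, j) \in Omega
                  then (usubmx v i 0 + dsubmx v j 0) ^+ 2
                  else usubmx v i 0 ^+ 2 + dsubmx v j 0 ^+ 2)
          + @plan R n m.+1 M eta x i ord_max * usubmx v i 0 ^+ 2).
Proof.
rewrite /H_sparse; move: (@plan R n m.+1 M eta x) => T.
rewrite -scalemxAl dotZr; congr (_ * _).
have widenE (j : 'I_m) : widen_ord (leq_pred m.+1) j = widen_ord (leqnSn m) j.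
  exact: val_inj.
set T0 := drop_last_col T.
rewrite -{2}(vsubmxK v) mul_block_col dot_submx col_mxKu col_mxKd.
set u := usubmx v; set w := dsubmx v.
(* The two off-diagonal blocks, being transposes, give the same bilinear form. *)
rewrite !dotDr !dot_diag_mx (dotC w)
  -[dot (_^T *m u) w]/(((_^T *m u)^T *m w) 0 0).
rewrite trmx_mul trmxK -mulmxA -[(u^T *m _) 0 0]/(dot u _) !dot_mulmx_sum.
have -> : \sum_i (T *m (const_mx 1 : 'cV[R]_m.+1)) i 0 * u i 0 ^+ 2 =
   \sum_i (\sum_(j < m) T i (widen_ord (leqnSn m) j) * u i 0 ^+ 2
          + T i ord_max * u i 0 ^+ 2).
  apply: eq_bigr => i _; rewrite mxE big_ord_recr/= mulrDl mulr_suml.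
  congr (_ + _); last by rewrite mxE mulr1.
  by apply: eq_bigr => j _; rewrite mxE mulr1.
have -> : \sum_j (T0^T *m (const_mx 1 : 'cV[R]_n)) j 0 * w j 0 ^+ 2 =
   \sum_i \sum_(j < m) T i (widen_ord (leqnSn m) j) * w j 0 ^+ 2.
  rewrite exchange_big/=; apply: eq_bigr => j _.
  rewrite mxE mulr_suml; apply: eq_bigr => i _.
  by rewrite !mxE mulr1 widenE.
rewrite -!big_split/=; apply: eq_bigr => i _.
rewrite addrAC -!addrA addrCA [RHS]addrC; congr (_ + _).
rewrite -!big_split/=; apply: eq_bigr => j _.
rewrite !mxE widenE; case: ifP => _; ring.
Qed.

Lemma H_sparse_sym (R : realType) (n m : nat) (M : 'M[R]_(n, m)) (eta : R)
    (Omega : {set 'I_n * 'I_m.-1}) (x : 'cV[R]_(n + m.-1)) :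
  (H_sparse M eta Omega x)^T = H_sparse M eta Omega x.
Proof. by rewrite /H_sparse linearZ/= tr_block_mx !tr_diag_mx trmxK. Qed.

Lemma H_sparse_bounds (R : realType) (n m : nat) (M : 'M[R]_(n, m.+1))
    (eta tl tu : R) (Omega : {set 'I_n * 'I_m}) (x v : 'cV[R]_(n + m)) :
  0 < eta ->
  (forall i j, tl <= @plan R n m.+1 M eta x i j <= tu) ->
  tl / eta * sqform Omega v <=
    dot v (@H_sparse R n m.+1 M eta Omega x *m v) <= tu / eta * sqform Omega v.
Proof.
move=> eta0 bx; rewrite H_sparse_form /sqform.
have eta'0 : 0 < eta^-1 by rewrite invr_gt0.
rewrite (mulrC tl) (mulrC tu) -!mulrA !ler_pM2l// !mulr_sumr.
apply/andP; split; apply: ler_sum => i _;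
  rewrite mulrDr mulr_sumr; (apply: lerD; first apply: ler_sum => j _);
  rewrite ler_wpM2r ?sqr_ge0//; try (by case/andP: (bx i ord_max));
  try (by case/andP: (bx i (widen_ord (leqnSn m) j)));
  by case: ifP => _; rewrite ?addr_ge0 ?sqr_ge0.
Qed.

(** * Decrease along a Wolfe step, and the optimality gap *)

(* With [D = d'Bd = - g'd]: the curvature condition gives
   [(1 - c2) D <= L gamma |d|^2 <= L gamma D / lam], and [|g|^2 <= Lam D]. *)
Lemma wolfe_decrease (R : realType) (p : nat) (F : 'cV[R]_p -> R) (B : 'M[R]_p)
    (x : 'cV[R]_p) (gamma c1 c2 lam Lam L : R) :
  0 < lam -> 0 < Lam -> 0 < L -> 0 < c1 -> c2 < 1 -> 0 < gamma ->
  B^T = B ->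
  (forall w, lam * dot w w <= dot w (B *m w)) ->
  (forall w, dot w (B *m w) <= Lam * dot w w) ->
  let g := gradient F x in
  let d := - (invmx B *m g) in
  wolfe F c1 c2 x d gamma ->
  (F (x + gamma *: d) <= F x ->
   dot (gradient F (x + gamma *: d) - g) (gamma *: d)
     <= L * dot (gamma *: d) (gamma *: d)) ->
  F (x + gamma *: d) <= F x - c1 * (1 - c2) * lam / (L * Lam) * dot g g.
Proof.
move=> lam0 Lam0 L0 c10 c21 gam0 sB Bl BL g d [].
rewrite -/g => armijo curv lip.
have gE : g = - (B *m d).
  by rewrite /d mulmxN opprK mulmxA mulmxV ?mul1mx// (posdef_unitmx lam0).
set D := dot d (B *m d).
have gd : dot g d = - D by rewrite gE dotNl dotC.
have D0 : 0 <= D by apply: le_trans (Bl d); rewrite mulr_ge0 ?dot_ge0// ltW.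
have gg : dot g g <= Lam * D.
  rewrite {1 2}gE dotNl dotNr opprK; apply: psd_image_bound => // w.
  by apply: le_trans (Bl w); rewrite mulr_ge0 ?dot_ge0// ltW.
rewrite gd in armijo curv.
have cgD : 0 <= c1 * gamma * D by rewrite !mulr_ge0// ltW.
(* The Armijo condition shows that [F] does not increase, which is the premise of the Lipschitz
   bound. *)
have {}lip := lip ltac:(lra).
rewrite dotZr dotDl dotNl gd dotZl dotZr in lip.
have {}lip : (1 - c2) * D <= L * gamma * dot d d.
  rewrite -(ler_pM2l gam0); apply: le_trans (_ : _ <= gamma * _) _; last first.
    by apply: (le_trans lip); rewrite le_eqVlt; apply/orP; left;
      apply/eqP; ring.
  by rewrite ler_pM2l//; lra.
have key : lam / L * (1 - c2) * D <= gamma * D.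
  apply: (@le_trans _ _ (lam / L * (L * gamma * dot d d))).
    by rewrite -mulrA ler_pM2l// divr_gt0.
  have -> : lam / L * (L * gamma * dot d d) = gamma * (lam * dot d d).
    by field; rewrite gt_eqF.
  by rewrite ler_pM2l.
apply: (le_trans armijo); rewrite mulrN lerD2l lerN2.
have -> : c1 * (1 - c2) * lam / (L * Lam) * dot g g =
   c1 * (1 - c2) * lam / L * (Lam^-1 * dot g g).
  by field; rewrite !gt_eqF.
apply: (@le_trans _ _ (c1 * (1 - c2) * lam / L * D)).
  rewrite ler_wpM2l ?ler_pdivrMl//.
  by rewrite divr_ge0 ?mulr_ge0// ?subr_ge0 ltW.
have -> : c1 * (1 - c2) * lam / L * D = c1 * (lam / L * (1 - c2) * D) by ring.
by rewrite -[leRHS]mulrA ler_pM2l.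
Qed.

(* Minimising the quadratic lower bound of strong convexity over [z - x];
   this needs no minimiser of [f]. *)
Lemma ot_dual_gap (R : realType) (n m : nat) (M : 'M[R]_(n, m.+1))
    (a : 'cV[R]_n) (b : 'cV[R]_m.+1) (eta tl : R) (x : 'cV[R]_(n + m)) :
  (0 < n)%N -> 0 < eta -> 0 < tl ->
  \sum_i a i 0 = 1 -> \sum_j b j 0 = 1 ->
  (forall z : 'cV[R]_(n + m.+1.-1),
    ot_dual M a b eta z <= @ot_dual R n m.+1 M a b eta x ->
    forall i j, tl <= plan M eta z i j) ->
  @ot_dual R n m.+1 M a b eta x - inf (range (@ot_dual R n m.+1 M a b eta)) <=
  2 * eta * m.+1%:R / tl *
    dot (gradient (@ot_dual R n m.+1 M a b eta) x)
        (gradient (@ot_dual R n m.+1 M a b eta) x).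
Proof.
move=> n0 eta0 tl0 a1 b1 bnd; set f := ot_dual M a b eta.
set g := gradient f x.
have m0 : 0 < m.+1%:R :> R by [].
have G0 : 0 <= 2 * eta * m.+1%:R / tl * dot g g.
  by rewrite mulr_ge0 ?dot_ge0// divr_ge0 ?mulr_ge0// ltW.
rewrite lerBlDr -lerBlDl; apply: lb_le_inf; first by exists (f x), x.
move=> _ [z _ <-]; rewrite lerBlDl -lerBlDr.
(* If [f z > f x] the difference is negative; otherwise [z] lies in the level set, where strong
   convexity is available. *)
have [zx|/ltW xz] := lerP (f z) (f x); last first.
  by apply: le_trans G0; rewrite subr_le0.
have := ot_dual_strongly_convex eta0 a1 b1 (bnd x (lexx _)) (bnd z zx).
rewrite -/f -/g sum_sqr_pot; move: (z - x) => w.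
have := @sqform_lb R n m [set: 'I_n * 'I_m] w n0 (finset.subsetT _).
set q := sqform _ _ => wq sc.
(* The modulus left once [sqform_lb] has replaced [q] by [|w|^2]. *)
pose nu := tl / (8 * eta * m.+1%:R).
have nu0 : 0 < nu by rewrite divr_gt0// !mulr_gt0.
have nq : nu * dot w w <= tl / (4 * eta) * q.
  have -> : tl / (4 * eta) * q = nu * (2 * m.+1%:R * q).
    by rewrite /nu; field; rewrite !gt_eqF.
  by rewrite ler_pM2l.
have -> : 2 * eta * m.+1%:R / tl * dot g g = dot g g / (4 * nu).
  by rewrite /nu; field; rewrite !gt_eqF.
have nu4 : 0 < 4 * nu by exact: mulr_gt0.
rewrite ler_pdivlMr//.
(* Completing the square: [- g'w - nu |w|^2 <= |g|^2 / (4 nu)]. *)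
have := dot_ge0 ((2 * nu) *: w + g).
rewrite !(dotDl, dotDr, dotZl, dotZr) (dotC w g) => sq.
have h : f x - f z <= - dot g w - nu * dot w w by lra.
apply: le_trans (ler_wpM2r _ h) _; first exact: ltW.
by lra.
Qed.

(** As [tau] may be arbitrarily close to 0, the lower bound rests on [H_sparse] alone; from above
    [tau] is at most [taumax]. *)
Lemma H_sparse_shift_bounds (R : realType) (n m : nat) (M : 'M[R]_(n, m.+1))
    (eta tl tu tau taumax : R) (Omega : {set 'I_n * 'I_m})
    (x : 'cV[R]_(n + m)) :
  (0 < n)%N -> 0 < eta -> 0 < tl -> 0 < tu -> 0 <= tau <= taumax ->
  Omega_star n m \subset Omega ->
  (forall i j, tl <= @plan R n m.+1 M eta x i j <= tu) ->
  let A := @H_sparse R n m.+1 M eta Omega x + tau%:M in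
  [/\ A^T = A,
     forall w, tl / eta / (2 * m.+1%:R) * dot w w <= dot w (A *m w)
   & forall w, dot w (A *m w) <=
       (tu / eta * (2 * (n + m.+1)%:R) + taumax) * dot w w].
Proof.
move=> n0 eta0 tl0 tu0 /andP[tau0 tau_le] sub bx.
have := @H_sparse_sym R n m.+1 M eta Omega x.
have := fun v => H_sparse_bounds Omega v eta0 bx.
move: (@H_sparse R n m.+1 M eta Omega x) => /= H Hb sH.
have formA w : dot w ((H + tau%:M) *m w) = dot w (H *m w) + tau * dot w w.
  by rewrite mulmxDl mul_scalar_mx dotDr dotZr.
split=> [|w|w].
- by rewrite linearD/= sH tr_scalar_mx.
- rewrite formA -[leLHS]addr0 lerD ?mulr_ge0 ?dot_ge0//.
  have /andP[lo _] := Hb w.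
  apply: le_trans lo; rewrite -[leLHS]mulrA ler_pM2l ?divr_gt0//.
  by rewrite ler_pdivrMl ?mulr_gt0//; apply: sqform_lb.
- rewrite formA mulrDl lerD ?ler_wpM2r ?dot_ge0//.
  have /andP[_ hi] := Hb w.
  apply: (le_trans hi); rewrite -[leRHS]mulrA ler_pM2l ?divr_gt0//.
  exact: sqform_ub.
Qed.

(** * Contraction of one step and convergence of the iterates *)

(** The factor is uniform over [Omega], the step size and both iterates, given the level [F]. The
    previous iterate must lie in the level set too, since the update relies on [y's >= mu s's]. *)
Lemma splr_step_contracts (R : realType) (n m : nat) (M : 'M[R]_(n, m.+1))
    (a : 'cV[R]_n) (b : 'cV[R]_m.+1) (eta taumax c1 c2 F : R) :
  (0 < n)%N -> 0 < eta -> (forall i, 0 < a i 0) -> (forall j, 0 < b j 0) ->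
  \sum_i a i 0 = 1 -> \sum_j b j 0 = 1 ->
  0 < taumax -> 0 < c1 -> c2 < 1 ->
  let f := @ot_dual R n m.+1 M a b eta in
  exists rho : R, 0 < rho /\ forall xm x xp : 'cV[R]_(n + m.+1.-1),
    f xm <= F -> f x <= F -> splr_step M a b eta taumax c1 c2 xm x xp ->
    f xp - inf (range f) <= (1 - rho) * (f x - inf (range f)).
Proof.
move=> n0 eta0 a0 b0 a1 b1 tau0 c10 c21 f.
have [tl [tu [tl0 tu0 bnd]]] := level_set_plan_bounds M F eta0 a0 b0 a1 b1.
have m0 : 0 < m.+1%:R :> R by [].
have nm0 : 0 < (n + m.+1)%:R :> R by rewrite ltr0n addnS.
(* [mu] bounds from below both the curvature of [f] and the form of [H + tau I]; [L] is the matching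
   upper bound for [f] and, up to [taumax], for [H + tau I]. *)
pose mu := tl / eta / (2 * m.+1%:R); pose L := tu / eta * (2 * (n + m.+1)%:R).
have mu0 : 0 < mu by rewrite !divr_gt0// mulr_gt0.
have L0 : 0 < L by rewrite mulr_gt0// ?divr_gt0// mulr_gt0.
(* The inverse of the constant in [lowrank_bounds] for [lam = mu]. *)
pose lam := (2 / mu + 4 * 10 ^+ 6 / (mu * mu) + 4 / mu)^-1.
have lam0 : 0 < lam.
  rewrite invr_gt0; apply: addr_gt0; last by rewrite divr_gt0.
  apply: addr_gt0; first by rewrite divr_gt0.
  by apply: divr_gt0; apply: mulr_gt0 => //; rewrite exprn_gt0.
pose Lam := L + taumax + 10 ^+ 6.
have Lam0 : 0 < Lam by rewrite !addr_gt0// exprn_gt0.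
pose kap := 2 * eta * m.+1%:R / tl.
have kap0 : 0 < kap by rewrite divr_gt0// !mulr_gt0.
pose C := c1 * (1 - c2) * lam / (L * Lam).
have C0 : 0 < C.
  have c2' : 0 < 1 - c2 by lra.
  exact: divr_gt0 (mulr_gt0 (mulr_gt0 c10 c2') lam0) (mulr_gt0 L0 Lam0).
have mon x z : f x <= F -> f z <= F ->
    mu * dot (x - z) (x - z) <= dot (gradient f x - gradient f z) (x - z) /\
    dot (gradient f x - gradient f z) (x - z) <= L * dot (x - z) (x - z).
  move=> xF zF.
  have := gradient_monotone_bounds eta0 a1 b1 (bnd x xF) (bnd z zF).
  rewrite -/f sum_sqr_pot => /andP[lo hi]; split.
    apply: le_trans lo; rewrite /mu -[leLHS]mulrA ler_pM2l ?divr_gt0//.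
    rewrite ler_pdivrMl ?mulr_gt0//; exact: sqform_lb.
  by apply: (le_trans hi); rewrite /L -[leRHS]mulrA ler_pM2l ?divr_gt0//
    sqform_ub.
(* One step gains at least [C |g|^2], while the gap is at most [kap |g|^2]. *)
exists (C / kap); split; first by rewrite divr_gt0.
move=> xm x xp xmF xF [W [gamma [subW gam0 wol ->]]].
move: wol; rewrite /splr_direction -/f.
(* Regrouping [B] as [(H + tau I) + R] shows [R] as the update of [A = H + tau I]. *)
set g := gradient f x; set tau := Num.min _ _; rewrite addrAC.
have tau_bnd : 0 <= tau <= taumax.
  by rewrite ge_min lexx andbT le_min ltW//= sqrtr_ge0.
have [] := H_sparse_shift_bounds n0 eta0 tl0 tu0 tau_bnd subW (bnd x xF).
rewrite -/mu -/L; move: (H_sparse _ _ _ _ + _) => A sA Al AL wol.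
have [sB Bl BL] := lowrank_bounds mu0 mu0 sA Al AL (mon _ _ xF xmF).1.
have {}Bl w : lam * dot w w <=
    dot w ((A + lowrank A (x - xm) (g - gradient f xm)) *m w).
  rewrite /lam ler_pdivrMl; [exact: Bl|by rewrite -invr_gt0].
have := wolfe_decrease lam0 Lam0 L0 c10 c21 gam0 sB Bl BL wol.
rewrite -/g -/C.
set d := - _ => dec.
have {}dec : f (x + gamma *: d) <= f x - C * dot g g.
  apply: dec => xpx.
  have := (mon _ _ (le_trans xpx xF) xF).2.
  by rewrite addrAC subrr add0r.
have gap : f x - inf (range f) <= kap * dot g g.
  apply: (ot_dual_gap n0 eta0 tl0 a1 b1) => z zx i j.
  by have /andP[] := bnd z (le_trans zx xF) i j.
have h : C / kap * (f x - inf (range f)) <= C * dot g g.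
  by rewrite -mulrA ler_pM2l// ler_pdivrMl.
by lra.
Qed.

Theorem theorem5p2 (R : realType) (n m : nat) (hn : (1 <= n)%N)
    (hm : (1 <= m)%N) (M : 'M[R]_(n, m)) (eta : R) (heta : 0 < eta)
    (a : 'cV[R]_n) (b : 'cV[R]_m)
    (ha : forall i, 0 < a i 0) (hb : forall j, 0 < b j 0)
    (hasum : \sum_(i < n) a i 0 = 1) (hbsum : \sum_(j < m) b j 0 = 1)
    (taumax c1 c2 : R) (htaumax : 0 < taumax)
    (hc1 : 0 < c1 < 1 / 2) (hc2 : c1 < c2 < 1)
    (S : nat) (hS : (2 <= S)%N)
    (xinit : 'cV[R]_(n + m.-1)) (x : nat -> 'cV[R]_(n + m.-1))
    (hsplr : forall k : nat, (1 <= k)%N ->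
       (forall i : nat, (1 <= i)%N -> k <> (i * S)%N) ->
       splr_step M a b eta taumax c1 c2
         (prev_iterate xinit x k) (x (k - 1)%N) (x k))
    (hmix : forall i k : nat, (1 <= i)%N -> k = (i * S)%N ->
       exists xq xs : 'cV[R]_(n + m.-1),
         splr_step M a b eta taumax c1 c2
           (prev_iterate xinit x k) (x (k - 1)%N) xq /\
         x k = (if ot_dual M a b eta xs <= ot_dual M a b eta xq
                then xs else xq)) :
  let f := ot_dual M a b eta in
  let fstar := inf (range f) in
  exists r : R, 0 < r < 1 /\
    forall k : nat, (1 <= k)%N ->
      f (x k) - fstar <= r * (f (x (k - 1)%N) - fstar).
Proof.
case: m hm M b hb hbsum xinit x hsplr hmix => // m _ M b hb hbsum xinit x hsplr
  hmix f fstar.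
have /andP[c10 _] := hc1; have /andP[_ c21] := hc2.
(* The first step takes its pair [(s, y)] from [xinit], whose value is unrelated to that of
   [x 0]. *)
pose F := Num.max (f (x 0%N)) (f xinit).
have [rho [rho0 step]] :=
  splr_step_contracts M F hn heta ha hb hasum hbsum htaumax c10 c21.
have fge z : 0 <= f z - fstar.
  rewrite subr_ge0; apply: ge_inf; last by exists z.
  exact: ot_dual_bounded_below.
have contr k : (1 <= k)%N -> f (prev_iterate xinit x k) <= F ->
    f (x (k - 1)%N) <= F ->
    f (x k) - fstar <= (1 - rho) * (f (x (k - 1)%N) - fstar).
  move=> k1 pF xF.
  (* At multiples of [S] the chosen point is no worse than the SPLR point and inherits its
     contraction. *)
  have [[i [i1 kE]]|no] := pselect (exists i, (1 <= i)%N /\ k = (i * S)%N).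
    have [xq [xs [/(step _ _ _ pF xF) h ->]]] := hmix i k i1 kE.
    by apply: le_trans h; rewrite lerD2r -/f; case: ifPn.
  by apply: (step _ _ _ pF xF); apply: hsplr => // i i1 kE; apply: no; exists i.
(* The induction covers all earlier indices because a step uses the two preceding iterates. *)
have xF k : forall l, (l <= k)%N -> f (x l) <= F.
  elim: k => [|k IH] l; first by rewrite leqn0 => /eqP ->; rewrite le_max lexx.
  rewrite leq_eqVlt ltnS => /orP[/eqP ->|]; last exact: IH.
  have := contr k.+1 isT; rewrite subn1/= => h.
  have xk := IH k (leqnn _).
  have : f (x k.+1) - fstar <= (1 - rho) * (f (x k) - fstar).
    apply: h => //; rewrite /prev_iterate; case: ifPn => _.
      by rewrite le_max lexx orbT.
    by apply: IH; rewrite subSS subn1 leq_pred.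
  by have := mulr_ge0 (ltW rho0) (fge (x k)); lra.
(* Only [rho > 0] is known, so [1 - rho] might not be positive; the maximum with [1/2] is. *)
exists (Num.max (1 - rho) (1 / 2)); split.
  rewrite lt_max gt_max; apply/andP; split; first by apply/orP; right; lra.
  by apply/andP; split; lra.
move=> k k1; apply: (le_trans (contr k k1 _ _)).
- rewrite /prev_iterate; case: ifPn => _; first by rewrite le_max lexx orbT.
  exact: (xF _ _ (leqnn _)).
- exact: (xF _ _ (leqnn _)).
- by rewrite ler_wpM2r// le_max lexx.
Qed.
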